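(* Let $(b,c)$ be a connected graph over a countable set $X$, and let $G$ be a nilpotent group acting cocompactly on $X$ such that the Schrödinger operator $H=H_{b,c}$ is $G$-invariant. Fix $x_0\in X$ and let $\mathcal{K}$ be the closure in $C(X)$ (product topology) of $\{f\in\mathcal{H}^+ : f(x_0)=1\}$. Then: (a) every element of $\mathcal{K}$ is $[G,G]$-invariant, where $[G,G]$ is the commutator subgroup of $G$; (b) every extreme point of the convex set $\mathcal{K}$ which is harmonic is multiplicative (i.e. $G$-multiplicative).
   Context: $X$ is a countable set. A graph over $X$ is a pair $(b,c)$ with $b:X\times X\to[0,\infty)$ and $c:X\to\mathbb{R}$ such that $\sum_{y\in X}b(x,y)<\infty$ for all $x$ ($b$ need not be symmetric). The graph is connected if for all $x,z\in X$ there is a finite sequence $x=y_1,\dots,y_n=z$ with $b(y_i,y_{i+1})>0$. $C(X)$ denotes the space of all real functions on $X$ with the product topology (pointwise convergence). $\mathrm{Dom}(H)=\{f\in C(X):\sum_y b(x,y)|f(y)|<\infty \ \forall x\}$ and $Hf(x)=\sum_{y}b(x,y)(f(x)-f(y))+c(x)f(x)$. A function $f\in\mathrm{Dom}(H)$ is harmonic if $Hf=0$; $\mathcal{H}^+$ is the set of nonnegative, not identically zero harmonic functions. For a group $G$ acting on $X$, $T_gf(x)=f(g^{-1}x)$. The action is cocompact if there is a finite $V\subseteq X$ with $GV=X$. $H$ is $G$-invariant if $T_g(\mathrm{Dom}(H))\subseteq\mathrm{Dom}(H)$ and $HT_g=T_gH$ for all $g\in G$. For a subgroup $R\subseteq G$,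 $f$ is $R$-invariant if $T_gf=f$ for all $g\in R$, and $f$ is $R$-multiplicative if there is a group homomorphism $\gamma:R\to(0,\infty)$ (multiplicative group) with $T_gf=\gamma(g^{-1})f$ for all $g\in R$; multiplicative means $G$-multiplicative. *)

(* Defs.v *)
From HB Require Import structures.
From mathcomp Require Import all_boot all_order all_algebra.
From mathcomp Require Import all_classical all_reals all_analysis.
Set Implicit Arguments. Unset Strict Implicit. Unset Printing Implicit Defensive.
Import Order.TTheory GRing.Theory Num.Theory.
Import numFieldNormedType.Exports.
Local Open Scope classical_set_scope.
Local Open Scope ring_scope.

Record group_on (G : Type) := GroupOn {
  gmul : G -> G -> G;
  gone : G;
  ginv : G -> G;
  gmulA : forall a b c, gmul a (gmul b c) = gmul (gmul a b) c;
  gmul1g : forall a, gmul gone a = a;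
  gmulVg : forall a, gmul (ginv a) a = gone }.

Section Groups.
Variables (G : Type) (Gs : group_on G).
Local Notation mul := (gmul Gs).
Local Notation one := (gone Gs).
Local Notation inv := (ginv Gs).

Definition is_subgroup (P : set G) : Prop :=
  P one /\ (forall a b, P a -> P b -> P (mul a b)) /\ (forall a, P a -> P (inv a)).

Definition gen_subgroup (S : set G) : set G :=
  fun x => forall P, is_subgroup P -> S `<=` P -> P x.

Definition gcomm (g h : G) : G := mul (mul (inv g) (inv h)) (mul g h).

Fixpoint lcs (n : nat) : set G :=
  match n with
  | 0 => setT
  | n'.+1 => gen_subgroup [set gcomm g h | g in lcs n' & h in setT]
  end.

Definition nilpotent_group : Prop := exists n, forall g, lcs n g -> g = one.

Definition commutator_subgroup : set G := lcs 1.

Definition is_action (X : Type) (act : G -> X -> X) : Prop :=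
  (forall x, act one x = x) /\ (forall g h x, act (mul g h) x = act g (act h x)).

Definition cocompact (X : Type) (act : G -> X -> X) : Prop :=
  exists V : set X, finite_set V /\ forall x, exists g v, V v /\ x = act g v.

End Groups.

Section Graphs.
Variables (R : realType) (X : countType).

Definition rsum (f : X -> R) : R :=
  fine (\esum_(y in [set: X]) (Num.max (f y) 0)%:E)
  - fine (\esum_(y in [set: X]) (Num.max (- f y) 0)%:E).

Definition is_graph (b : X -> X -> R) (c : X -> R) : Prop :=
  (forall x y, 0 <= b x y) /\
  (forall x, (\esum_(y in [set: X]) (b x y)%:E < +oo)%E).

Definition connected_graph (b : X -> X -> R) : Prop :=
  forall x z, exists s : seq X, path (fun u v => 0 < b u v) x s /\ last x s = z.

Definition DomH (b : X -> X -> R) (f : X -> R) : Prop :=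
  forall x, (\esum_(y in [set: X]) (b x y * `|f y|)%:E < +oo)%E.

Definition Hop (b : X -> X -> R) (c : X -> R) (f : X -> R) : X -> R :=
  fun x => rsum (fun y => b x y * (f x - f y)) + c x * f x.

Definition harmonic_fun b c (f : X -> R) : Prop := DomH b f /\ forall x, Hop b c f x = 0.

Definition Hplus b c : set (X -> R) :=
  [set f | harmonic_fun b c f /\ (forall x, 0 <= f x) /\ exists x, f x != 0].

Definition Tg (G : Type) (Gs : group_on G) (act : G -> X -> X) (g : G)
  (f : X -> R) : X -> R := fun x => f (act (ginv Gs g) x).

Definition H_invariant (G : Type) (Gs : group_on G) (act : G -> X -> X)
  (b : X -> X -> R) (c : X -> R) : Prop :=
  forall g f, DomH b f -> DomH b (Tg Gs act g f) /\
    Hop b c (Tg Gs act g f) = Tg Gs act g (Hop b c f).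

Definition Kset b c (x0 : X) : set (X -> R) :=
  closure ([set f | Hplus b c f /\ f x0 = 1] : set {ptws X -> R}).

Definition extreme_pt (K : set (X -> R)) (f : X -> R) : Prop :=
  K f /\ forall g h (t : R), K g -> K h -> 0 < t < 1 ->
    f = (fun x => t * g x + (1 - t) * h x) -> g = f /\ h = f.

Definition invariant_on (G : Type) (Gs : group_on G) (act : G -> X -> X)
  (P : set G) (f : X -> R) : Prop := forall g, P g -> Tg Gs act g f = f.

Definition multiplicative_fun (G : Type) (Gs : group_on G) (act : G -> X -> X)
  (f : X -> R) : Prop :=
  exists gam : G -> R, (forall g, 0 < gam g) /\
    (forall g h, gam (gmul Gs g h) = gam g * gam h) /\
    (forall g, Tg Gs act g f = (fun x => gam (ginv Gs g) * f x)).

End Graphs.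

(* Main.v *)
(** For a nonnegative harmonic function [f] and a group element [z], put
    [M = sup f(z x) / f(x)] over all [f] and [x]; if [z] is central modulo the
    elements acting trivially on all such [f], then [M] is finite by cocompactness
    and the Harnack inequality. If [f(z v)] is close to [M f(v)], the nonnegative
    harmonic function [M f - f o z] is small at [v], so Harnack forces
    [f(z^j v)] to be close to [M^j f(v)]. For [z = [g,h]] one has
    [z^(n^2) = [g^n,h^n]], so [f(z^(n^2) v) <= C^n f(v)]; hence [M^(n^2) <= C^n]
    for all [n] and [M <= 1]. Descending along the lower central series shows that
    [G,G] acts trivially. Consequently [T_g f <= C f] for every [g], and an
    extreme harmonic [f], being a convex combination of the normalizations of
    [T_g f] and [(C + 1) f - T_g f], is multiplicative. *)
Require Import Defs.
From HB Require Import structures.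
From mathcomp Require Import all_boot all_order all_algebra.
From mathcomp Require Import all_classical all_reals all_analysis.
From mathcomp Require Import ring lra.
Import Order.TTheory GRing.Theory Num.Theory.
Import numFieldNormedType.Exports.
Local Open Scope classical_set_scope.
Local Open Scope ring_scope.
Set Implicit Arguments. Unset Strict Implicit.

(** * Sums of nonnegative families with finite total *)

Section NonnegativeSums.
Variables (R : realType) (X : countType).
Implicit Types p q f : X -> R.

Definition fin_sum p : Prop :=
  (forall y, 0 <= p y) /\ (\esum_(y in [set: X]) (p y)%:E < +oo)%E.

Definition nsum p : R := fine (\esum_(y in [set: X]) (p y)%:E).

Lemma nsumE p : fin_sum p -> \esum_(y in [set: X]) (p y)%:E = (nsum p)%:E.
Proof.
move=> [p0 pfin]; rewrite /nsum fineK// ge0_fin_numE// esum_ge0// => y _.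
by rewrite lee_fin.
Qed.

Lemma nsum_ge0 p : (forall y, 0 <= p y) -> 0 <= nsum p.
Proof. by move=> p0; apply/fine_ge0/esum_ge0 => y _; rewrite lee_fin. Qed.

Lemma le_fin_sum p q : (forall y, 0 <= p y <= q y) -> fin_sum q -> fin_sum p.
Proof.
move=> pq [q0 qfin]; split=> [y|]; first by case/andP: (pq y).
apply: le_lt_trans qfin; apply: le_esum => y _.
by rewrite lee_fin; case/andP: (pq y).
Qed.

Lemma esum_fin_sumD p q : fin_sum p -> fin_sum q ->
  \esum_(y in [set: X]) (p y + q y)%:E = (nsum p + nsum q)%:E.
Proof.
move=> Fp Fq; rewrite EFinD -!nsumE// -esumD//.
- by move=> y _; rewrite lee_fin; apply: Fp.1.
- by move=> y _; rewrite lee_fin; apply: Fq.1.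
Qed.

Lemma nsumD p q : fin_sum p -> fin_sum q ->
  nsum (fun y => p y + q y) = nsum p + nsum q.
Proof. by move=> Fp Fq; rewrite {1}/nsum esum_fin_sumD. Qed.

Lemma esum_scale_le (t : R) p : 0 <= t -> fin_sum p ->
  (\esum_(y in [set: X]) (t * p y)%:E <= (t * nsum p)%:E)%E.
Proof.
move=> t0 Fp; apply: ge_ereal_sup => _ [A FA <-].
under eq_fsbigr do rewrite EFinM.
have [finA _] := FA.
rewrite -ge0_mule_fsumr; last by move=> y; rewrite lee_fin Fp.1.
rewrite EFinM; apply: lee_wpmul2l; first by rewrite lee_fin.
by rewrite -nsumE//; apply: esum_ge; exists A.
Qed.

Lemma fin_sumZ (t : R) p : 0 <= t -> fin_sum p -> fin_sum (fun y => t * p y).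
Proof.
move=> t0 Fp; split=> [y|]; first by rewrite mulr_ge0// Fp.1.
exact: le_lt_trans (esum_scale_le t0 Fp) (ltry _).
Qed.

Lemma nsumZ (t : R) p : 0 <= t -> fin_sum p ->
  nsum (fun y => t * p y) = t * nsum p.
Proof.
move=> t0 Fp; have Ftp := fin_sumZ t0 Fp.
apply/le_anti/andP; split.
  by rewrite -lee_fin -nsumE//; exact: esum_scale_le.
have [->|tn0] := eqVneq t 0.
  by rewrite mul0r nsum_ge0// => y; rewrite mul0r.
have {tn0}t_gt0 : 0 < t by rewrite lt0r tn0.
rewrite mulrC -ler_pdivlMr// mulrC.
rewrite -lee_fin -nsumE//.
have -> : (fun y => (p y)%:E) = (fun y => (t^-1 * (t * p y))%:E).
  by apply/funext => y; rewrite mulrA mulVf ?mul1r// gt_eqF.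
by apply: esum_scale_le => //; rewrite invr_ge0 ltW.
Qed.

Lemma nsum_ge_term p y : fin_sum p -> p y <= nsum p.
Proof.
move=> Fp; rewrite -lee_fin -nsumE//; apply: esum_ge; exists [set y].
  by split.
by rewrite fsbig_set1.
Qed.

(** The positive and negative parts of [p - q] are dominated by [p] and [q], so they are summable;
    summing the pointwise identity [(p - q)^+ + q = (p - q)^- + p] gives the claim. *)
Lemma rsumB p q : fin_sum p -> fin_sum q ->
  rsum (fun y => p y - q y) = nsum p - nsum q.
Proof.
move=> Fp Fq.
have Fpos : fin_sum (fun y => Num.max (p y - q y) 0).
  apply: (le_fin_sum _ Fp) => y; rewrite le_max lexx orbT/= ge_max Fp.1 andbT.
  by rewrite lerBlDr lerDl Fq.1.
have Fneg : fin_sum (fun y => Num.max (- (p y - q y)) 0).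
  apply: (le_fin_sum _ Fq) => y; rewrite le_max lexx orbT/= ge_max Fq.1 andbT.
  by rewrite opprB lerBlDr lerDl Fp.1.
have : nsum (fun y => Num.max (p y - q y) 0 + q y) =
       nsum (fun y => Num.max (- (p y - q y)) 0 + p y).
  congr nsum; apply/funext => y.
  case: (leP (p y - q y) 0) => h; case: (leP (- (p y - q y)) 0) => h'; lra.
rewrite !nsumD// /rsum -/(nsum (fun y => Num.max (p y - q y) 0)).
rewrite -/(nsum (fun y => Num.max (- (p y - q y)) 0)).
by move=> E; lra.
Qed.

End NonnegativeSums.

(** Bernoulli's inequality and the Archimedean property. The exponent is a successor so that roots
    of that order can be compared later. *)
Lemma unbounded_expr (R : realType) (M C : R) : 1 < M -> exists n, C < M ^+ n.+1.
Proof.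
move=> M1; have bern n : 1 + n%:R * (M - 1) <= M ^+ n.
  elim: n => [|n IH]; first by rewrite mul0r addr0 expr0.
  have : M * (1 + n%:R * (M - 1)) <= M * M ^+ n by rewrite ler_wpM2l//; lra.
  have : 0 <= n%:R * (M - 1) * (M - 1) by rewrite !mulr_ge0//; lra.
  rewrite exprS -(natr1 n); lra.
have M10 : 0 < M - 1 by lra.
have := archi_boundP (normr_ge0 (C / (M - 1))).
set n := Num.bound _ => hn; exists n.
apply: lt_le_trans (bern n.+1); rewrite -natr1.
have : C < n%:R * (M - 1).
  by rewrite -ltr_pdivrMr//; apply: le_lt_trans hn; exact: ler_norm.
lra.
Qed.

(** * Abstract translation-invariant cones of nonnegative functions with a Harnack inequality *)

Section HarnackCone.
Variables (R : realType) (X : countType).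
Variables (G : Type) (Gs : group_on G) (act : G -> X -> X).
Variables (P : set (X -> R)) (V : set X).
Hypothesis act_action : is_action Gs act.
Hypothesis finV : finite_set V.
Hypothesis coverV : forall x, exists g v, V v /\ x = act g v.
Hypothesis P_ge0 : forall f x, P f -> 0 <= f x.
Hypothesis P_act : forall g f, P f -> P (fun x => f (act g x)).
Hypothesis P_sub : forall M f h, 0 <= M -> P f -> P h ->
  (forall x, h x <= M * f x) -> P (fun x => M * f x - h x).
Hypothesis P_harnack : forall x z, exists2 C : R, 0 <= C &
  forall f, P f -> f z <= C * f x.

Local Notation mul := (gmul Gs).
Local Notation one := (gone Gs).
Local Notation inv := (ginv Gs).
Implicit Types (f : X -> R) (g h k z : G) (C M : R).

(** Since [V] is finite, the Harnack constants of the pairs [(w, phi w)], in both directions, can be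
    added up over [V]. *)
Lemma uniform_harnack (phi : X -> X) : exists2 C, 0 <= C &
  forall f v, P f -> V v -> f (phi v) <= C * f v /\ f v <= C * f (phi v).
Proof.
have /finite_seqP[s ->] := finV.
elim: s => [|w s [C C0 HC]]; first by exists 0.
have [C1 C10 HC1] := P_harnack w (phi w).
have [C2 C20 HC2] := P_harnack (phi w) w.
exists (C + C1 + C2) => [|f v Pf /=]; first by rewrite !addr_ge0.
have fv0 := P_ge0 v Pf; have fpv0 := P_ge0 (phi v) Pf.
rewrite inE => /orP[/eqP vw|/(HC f v Pf)[h1 h2]].
  rewrite vw in fv0 fpv0 *; move: (HC1 f Pf) (HC2 f Pf) => h1 h2.
  by split; [apply: le_trans h1 _|apply: le_trans h2 _];
    rewrite ler_wpM2r// ?lerDr -?addrA ?lerDl ?lerDr ?addr_ge0//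
      addrCA lerDl addr_ge0.
by split; [apply: le_trans h1 _|apply: le_trans h2 _];
  rewrite ler_wpM2r// -addrA lerDl addr_ge0.
Qed.

Lemma P_iter f g n : P f -> P (fun x => f (iter n (act g) x)).
Proof. by elim: n f => [//|n IH] f Pf; apply: IH (P_act g Pf). Qed.

Lemma actK g : cancel (act g) (act (inv g)).
Proof. by move=> x; rewrite -act_action.2 gmulVg act_action.1. Qed.

Lemma actKV g : cancel (act (inv g)) (act g).
Proof.
by move=> x; rewrite -[LHS](actK (inv g)) (actK g) (actK (inv g)).
Qed.

Lemma iter_actK g n x : iter n (act (inv g)) (iter n (act g) x) = x.
Proof. by elim: n => [//|n IH]; rewrite iterSr iterS actK. Qed.

Lemma iter_growth C g : 0 <= C ->
  (forall f v, P f -> V v -> f (act g v) <= C * f v /\ f v <= C * f (act g v)) ->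
  forall n f v, P f -> V v -> f (iter n (act g) v) <= C ^+ n * f v /\
    f v <= C ^+ n * f (iter n (act g) v).
Proof.
move=> C0 HC; elim=> [|n IH] f v Pf Vv; first by rewrite expr0 mul1r.
(* The constant [C] is only valid on [V], so the induction translates the function and keeps the
   point [v] in [V]. *)
have [h1 h2] := IH _ v (P_act g Pf) Vv; have [h3 h4] := HC f v Pf Vv.
rewrite iterS exprSr; split.
  by apply: le_trans h1 _; rewrite -mulrA ler_wpM2l// exprn_ge0.
by apply: le_trans h4 _; rewrite -exprSr exprS -mulrA ler_wpM2l.
Qed.

(** * Growth along an element that is central as seen by the cone *)

Section Central.
Variable z : G.
Hypothesis z_central : forall k f x, P f ->
  f (act z (act k x)) = f (act k (act z x)).

Lemma central_iterr k n f x : P f ->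
  f (act z (iter n (act k) x)) = f (iter n (act k) (act z x)).
Proof.
elim: n f => [//|n IH] f Pf; rewrite !iterS z_central//.
exact: IH (P_act k Pf).
Qed.

Lemma central_iter k m n f x : P f ->
  f (iter m (act z) (iter n (act k) x)) = f (iter n (act k) (iter m (act z) x)).
Proof.
elim: m f => [//|m IH] f Pf; rewrite !iterS.
by rewrite (IH _ (P_act z Pf)) central_iterr.
Qed.

(** [M] is the infimum of the admissible constants. One exists because centrality lets a point
    [act k v] be moved to [v] in [V] by replacing [f] with its translate by [k]; the same
    translation brings near-extremal pairs into [V]. *)
Lemma growth_bound : exists2 M, 0 <= M &
  (forall f x, P f -> f (act z x) <= M * f x) /\
  (forall e, 0 < e <= M -> exists f v,
     [/\ P f, V v, 0 < f v & (M - e) * f v < f (act z v)]).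
Proof.
pose E := [set C | 0 <= C /\ forall f x, P f -> f (act z x) <= C * f x].
have [C C0 HC] := uniform_harnack (act z).
have EC : E C.
  split=> // f x Pf; have [k [v [Vv ->]]] := coverV x.
  by rewrite z_central//; apply: (HC _ v (P_act k Pf) Vv).1.
have lbE : has_lbound E by exists 0 => y [].
have E0 : E !=set0 by exists C.
exists (inf E); first by apply: lb_le_inf => // y [].
split=> [f x Pf|e /andP[e0 eM]].
  have := P_ge0 x Pf; rewrite le_eqVlt => /orP[/eqP fx|fx].
    by have := EC.2 f x Pf; rewrite -fx !mulr0.
  rewrite -ler_pdivrMr//; apply: lb_le_inf => // y [_ Hy].
  by rewrite ler_pdivrMr// Hy.
apply: contrapT => Hno; suff : E (inf E - e).
  by move=> /(ge_inf lbE); rewrite lerBrDr gerDl leNgt e0.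
split=> [|f x Pf]; first by rewrite subr_ge0.
rewrite leNgt; apply/negP => hlt; apply: Hno.
have [k [v [Vv xE]]] := coverV x; rewrite xE z_central// in hlt.
exists (fun y => f (act k y)), v; split => //; first exact: P_act.
(* If the translate vanished at [v], Harnack would make it vanish at [act z v], against the strict
   inequality [hlt]. *)
rewrite lt0r (P_ge0 v (P_act k Pf)) andbT; apply/eqP => fv0.
by have := (HC _ v (P_act k Pf) Vv).1; rewrite leNgt fv0 mulr0 -(mulr0 (inf E - e)) -{1}fv0 hlt.
Qed.

Lemma near_extremal_iter M : 0 <= M ->
  (forall f x, P f -> f (act z x) <= M * f x) ->
  forall j, exists2 D, 0 <= D & forall e f v, 0 < e -> P f -> V v ->
    (M - e) * f v < f (act z v) ->
    (M ^+ j - e * D) * f v <= f (iter j (act z) v).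
Proof.
move=> M0 HM; elim=> [|j [D D0 HD]].
  by exists 0 => // e f v *; rewrite mulr0 subr0 mul1r.
have [C C0 HC] := uniform_harnack (iter j (act z)).
(* Harnack for [u = M f - f o z], with [u(v) <= e f(v)], gives
   [f(z^(j+1) v) >= M f(z^j v) - C e f(v)]; hence the recursion [D' = M D + C]. *)
exists (M * D + C) => [|e f v e0 Pf Vv hlt]; first by rewrite addr_ge0 ?mulr_ge0.
have Pu := P_sub M0 Pf (P_act z Pf) (fun x => HM f x Pf).
have [/= h1 _] := HC _ v Pu Vv.
have h2 := ler_wpM2l M0 (HD e f v e0 Pf Vv hlt).
have h3 : C * (M * f v - f (act z v)) <= C * (e * f v).
  by rewrite ler_wpM2l//; lra.
rewrite /= exprS.
set y := f (act z _) in h1 *; set w := f (iter j _ _) in h1 h2.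
have -> : (M * M ^+ j - e * (M * D + C)) * f v =
  M * ((M ^+ j - e * D) * f v) - C * (e * f v) by ring.
lra.
Qed.

Variables g h : G.
Hypothesis gh_comm : forall f x, P f ->
  f (act g (act h x)) = f (act h (act g (act z x))).

Lemma comm_iterr n f x : P f -> f (act g (iter n (act h) x)) =
  f (iter n (act h) (act g (iter n (act z) x))).
Proof.
elim: n f x => [//|n IH] f x Pf; rewrite iterS gh_comm//.
rewrite (central_iterr h n x (P_act g (P_act h Pf))).
by rewrite (IH _ (act z x) (P_act h Pf)) -iterSr.
Qed.

(** The Heisenberg relation [g^m h^n = h^n g^m z^(m n)]: each exchange of a [g] with an [h] releases
    one central [z]. *)
Lemma comm_iter m n f x : P f -> f (iter m (act g) (iter n (act h) x)) =
  f (iter n (act h) (iter m (act g) (iter (m * n) (act z) x))).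
Proof.
elim: m f x => [//|m IH] f x Pf; rewrite iterS (IH _ _ (P_act g Pf)).
rewrite comm_iterr// (central_iter g n m _ (P_act g (P_iter h n Pf))).
by rewrite -iterS -iterD mulSn.
Qed.

Lemma central_growth : exists2 C, 0 <= C & forall n f v, P f -> V v ->
  f (iter (n * n) (act z) v) <= C ^+ n * f v.
Proof.
have [C C0 HC] := uniform_harnack (act g).
have [D D0 HD] := uniform_harnack (act h).
exists (D * C * (D * C)) => [|n f v Pf Vv]; first by rewrite !mulr_ge0.
(* [F] undoes [h^n g^n], so it takes the value [f(z^(n^2) v)] at [g^n h^n v] and [f(v)] at
   [h^n g^n v]. Both points are compared with [v] at a cost of [n] Harnack steps in [g] and [n] in
   [h], whence [(D C D C)^n]. *)
pose F y := f (iter n (act (inv g)) (iter n (act (inv h)) y)).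
have PF : P F.
  exact: P_iter (inv h) n (P_iter (inv g) n Pf).
have -> : f (iter (n * n) (act z) v) = F (iter n (act g) (iter n (act h) v)).
  by rewrite comm_iter// /F !iter_actK.
have -> : f v = F (iter n (act h) (iter n (act g) v)) by rewrite /F !iter_actK.
have [h1 _] := iter_growth D0 HD n (P_iter g n PF) Vv.
have [h2 _] := iter_growth C0 HC n PF Vv.
have [_ h3] := iter_growth D0 HD n PF Vv.
have [_ h4] := iter_growth C0 HC n (P_iter h n PF) Vv.
apply: le_trans h1 _; rewrite !exprMn -!mulrA ler_wpM2l ?exprn_ge0//.
apply: le_trans h2 _; rewrite ler_wpM2l ?exprn_ge0//.
by apply: le_trans h3 _; rewrite ler_wpM2l ?exprn_ge0.
Qed.

Lemma central_commutator_le f x : P f -> f (act z x) <= f x.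
Proof.
have [M M0 [HM Mext]] := growth_bound.
move=> Pf; apply: le_trans (HM f x Pf) _.
rewrite ler_piMl ?P_ge0// leNgt; apply/negP => M1.
have [C C0 HC] := central_growth.
have pow_le n : M ^+ (n * n) <= C ^+ n.
  have [D D0 HD] := near_extremal_iter M0 HM (n * n).
  rewrite leNgt; apply/negP => hlt.
  set d := M ^+ (n * n) - C ^+ n; have d0 : 0 < d by rewrite subr_gt0.
  (* The choice [e = d / (d + D + 1)] ensures both [e <= 1 < M], as [Mext] requires, and [e D < d],
     which contradicts the gap [d]. *)
  have s0 : 0 < d + D + 1 by lra.
  have e0 : 0 < d / (d + D + 1) by rewrite divr_gt0.
  have e1 : d / (d + D + 1) <= 1 by rewrite ler_pdivrMr//; lra.
  have [|f' [v [Pf' Vv fv0 hv]]] := Mext (d / (d + D + 1)).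
    by rewrite e0; lra.
  have := le_trans (HD _ _ _ e0 Pf' Vv hv) (HC n _ _ Pf' Vv).
  rewrite ler_pM2r// => hle.
  have : d / (d + D + 1) * D < d.
    by rewrite mulrAC ltr_pdivrMr// mulrDr mulr1 -subr_gt0; nra.
  rewrite /d in hle *; lra.
have [n] := unbounded_expr C M1.
(* Taking roots of order [n.+1] in [M^((n+1)^2) <= C^(n+1)] bounds all positive powers of [M] by
   [C]. *)
rewrite ltNge -(@ler_pXn2r _ n.+1)// ?nnegrE ?exprn_ge0//.
by rewrite -exprM pow_le.
Qed.

End Central.

(** * Elements acting trivially on the cone, and descent along the lower central series *)

Definition cone_kernel : set G :=
  [set g | forall f x, P f -> f (act g x) = f x].

Lemma cone_kernel_subgroup : is_subgroup Gs cone_kernel.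
Proof.
split=> [f x _|]; first by rewrite act_action.1.
split=> [g h Ng Nh f x Pf|g Ng f x Pf].
  by rewrite act_action.2 Ng// Nh.
by rewrite -[in RHS](actKV g x) Ng.
Qed.

(** The one-sided bound applies to [[g,h]] and to its inverse [[h,g]], which is central in the same
    sense; together they give equality. *)
Lemma central_commutator_kernel g h :
  (forall k f x, P f -> f (act (gcomm Gs g h) (act k x)) =
    f (act k (act (gcomm Gs g h) x))) ->
  cone_kernel (gcomm Gs g h).
Proof.
have commE a d x : act (gcomm Gs a d) x =
    act (inv a) (act (inv d) (act a (act d x))).
  by rewrite /gcomm !act_action.2.
have comm_comm a d x : act a (act d x) = act d (act a (act (gcomm Gs a d) x)).
  by rewrite commE !actKV.
have commK a d x : act (gcomm Gs d a) (act (gcomm Gs a d) x) = x.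
  by rewrite [act (gcomm Gs d a) _]commE -comm_comm !actK.
move=> z_central f x Pf; apply/le_anti/andP; split.
  apply: (central_commutator_le z_central (g := g) (h := h)) => // f' y Pf'.
  by rewrite -comm_comm.
have z'_central k f' y : P f' -> f' (act (gcomm Gs h g) (act k y)) =
    f' (act k (act (gcomm Gs h g) y)).
  move=> Pf'; rewrite -[in LHS](commK h g y).
  by rewrite -(z_central k _ _ (P_act (gcomm Gs h g) Pf')) commK.
rewrite -[in leLHS](commK g h x).
apply: (central_commutator_le z'_central (g := h) (h := g)) => // f' y Pf'.
by rewrite -comm_comm.
Qed.

Lemma lcs_kernel m i : lcs Gs (i.+1 + m) `<=` cone_kernel ->
  lcs Gs i.+1 `<=` cone_kernel.
Proof.
elim: m i => [|m IH] i; first by rewrite addn0.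
rewrite addnS -addSn => /IH lcs_next g; apply; first exact: cone_kernel_subgroup.
move=> _ [a lcsa [d _ <-]]; apply: central_commutator_kernel => k f x Pf.
have : lcs Gs i.+1 (gcomm Gs a d).
  by move=> Q _; apply; exists a => //; exists d.
move: (gcomm Gs a d) => z lcsz.
(* The commutator [[z,k]] lies one step further down the series, hence in the kernel. As [z k = k z
   [z,k]], the element [z] is central as seen by the cone. *)
have Nzk : cone_kernel (gcomm Gs z k).
  by apply: lcs_next => Q _; apply; exists z => //; exists k.
rewrite -(Nzk _ x (P_act z (P_act k Pf))).
by rewrite /gcomm !act_action.2 !actKV.
Qed.

Lemma commutator_subgroup_kernel : nilpotent_group Gs ->
  commutator_subgroup Gs `<=` cone_kernel.
Proof.
case=> -[|n] nil; last first.
  by apply: (@lcs_kernel n 0) => g /nil -> f x _; rewrite act_action.1.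
by move=> g _ f x _; rewrite (nil g)// act_action.1.
Qed.

End HarnackCone.

Lemma closed_equalizer (R : realType) (T : topologicalType) (u v : T -> R) :
  continuous u -> continuous v -> closed [set t | u t = v t].
Proof.
move=> cu cv.
have -> : [set t | u t = v t] = (fun t => u t - v t) @^-1` [set r | r = 0].
  by apply/seteqP; split=> t /= => [->|/eqP]; rewrite ?subrr// subr_eq0 => /eqP.
apply: preimage_closed; last exact: closed_eq.
by move=> t _; apply: cvgB; [exact: cu|exact: cv].
Qed.

(** * Nonnegative harmonic functions form such a cone *)

Section PositiveHarmonic.
Variables (R : realType) (X : countType) (b : X -> X -> R) (c : X -> R).
Hypothesis graph_bc : is_graph b c.
Hypothesis conn : connected_graph b.
Implicit Types (f h : X -> R).

Definition nneg_harmonic : set (X -> R) :=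
  [set f | (forall x, 0 <= f x) /\ harmonic_fun b c f].

(** Turns the signed sum in [Hop] into an identity between nonnegative sums, the form used for
    linear combinations and for Harnack. *)
Lemma nneg_harmonicP f : (forall x, 0 <= f x) ->
  harmonic_fun b c f <-> (forall x, fin_sum (fun y => b x y * f y)) /\
    (forall x, nsum (fun y => b x y * f y) = (nsum (b x) + c x) * f x).
Proof.
move=> f0; have [b0 bfin] := graph_bc.
have DomE : DomH b f <-> forall x, fin_sum (fun y => b x y * f y).
  have absE x : (fun y => (b x y * `|f y|)%:E) = (fun y => (b x y * f y)%:E).
    by apply/funext => y; rewrite ger0_norm.
  split=> [D x|D x]; last by rewrite absE; apply: (D x).2.
  by split=> [y|]; rewrite ?mulr_ge0// -absE; apply: D.
have HopE x : fin_sum (fun y => b x y * f y) ->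
    Hop b c f x = (nsum (b x) + c x) * f x - nsum (fun y => b x y * f y).
  move=> Fbf; have Fb : fin_sum (b x) by split=> //; apply: bfin.
  rewrite /Hop; have -> : (fun y => b x y * (f x - f y)) =
      (fun y => f x * b x y - b x y * f y) by apply/funext => y; ring.
  by rewrite rsumB ?nsumZ//; [ring|exact: fin_sumZ].
split=> [[/DomE D H]|[D H]].
  split=> // x; move: (H x); rewrite HopE// => /eqP.
  by rewrite subr_eq0 => /eqP.
split; first exact/DomE.
by move=> x; rewrite HopE// H subrr.
Qed.

Lemma nneg_harmonic_sub M f h : 0 <= M -> nneg_harmonic f -> nneg_harmonic h ->
  (forall x, h x <= M * f x) -> nneg_harmonic (fun x => M * f x - h x).
Proof.
move=> M0 [f0 Hf] [h0 Hh] hf; have b0 := graph_bc.1.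
have [Ff Ef] := (nneg_harmonicP f0).1 Hf.
have [Fh Eh] := (nneg_harmonicP h0).1 Hh.
have u0 x : 0 <= M * f x - h x by rewrite subr_ge0.
split=> //; apply/(nneg_harmonicP u0).
have Fu x : fin_sum (fun y => b x y * (M * f y - h y)).
  apply: (le_fin_sum _ (fin_sumZ M0 (Ff x))) => y.
  rewrite mulr_ge0//= mulrBr mulrCA lerBlDr lerDl mulr_ge0//.
(* Adding the sum of [b h] back keeps all families nonnegative; the value for [M f - h] follows by
   subtraction. *)
split=> // x; have := nsumD (Fu x) (Fh x).
have -> : (fun y => b x y * (M * f y - h y) + b x y * h y) =
  (fun y => M * (b x y * f y)) by apply/funext => y; ring.
rewrite nsumZ// Ef Eh => E.
have -> : nsum (fun y => b x y * (M * f y - h y)) =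
  M * ((nsum (b x) + c x) * f x) - (nsum (b x) + c x) * h x by rewrite E addrK.
by ring.
Qed.

(** Along an edge, one term of the harmonic equation is at most the whole sum:
    [b x y * f y <= (nsum (b x) + c x) * f x]. These bounds multiply along a path. The absolute
    value keeps the constant nonnegative, since [c] may be negative. *)
Lemma harnack x z : exists2 C : R, 0 <= C &
  forall f, nneg_harmonic f -> f z <= C * f x.
Proof.
have [s [ps <-]] := conn x z.
elim: s x ps => [x _|y s IH x /= /andP[bxy ps]].
  by exists 1 => // f _; rewrite mul1r.
have [C C0 HC] := IH _ ps.
exists (C * (`|nsum (b x) + c x| / b x y)) => [|f Pf].
  by rewrite mulr_ge0// divr_ge0// ltW.
apply: le_trans (HC f Pf) _; rewrite -mulrA ler_wpM2l//.
have [f0 Hf] := Pf; have [Ff Ef] := (nneg_harmonicP f0).1 Hf.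
rewrite mulrAC ler_pdivlMr// mulrC.
apply: le_trans (nsum_ge_term y (Ff x)) _.
by rewrite Ef ler_wpM2r// ler_norm.
Qed.

Lemma Hplus_pos f x : Hplus b c f -> 0 < f x.
Proof.
move=> [Hf [f0 [y fy]]]; rewrite lt0r f0 andbT.
apply: contra_neq fy => fx; have [C _ HC] := harnack x y.
by apply/le_anti; rewrite f0 -[leRHS](mulr0 C) -fx HC.
Qed.

Lemma Hplus_nneg_harmonic f : Hplus b c f -> nneg_harmonic f.
Proof. by move=> [? []]. Qed.

Lemma nneg_harmonic_Hplus f x : nneg_harmonic f -> 0 < f x -> Hplus b c f.
Proof. by move=> [f0 Hf] fx; split=> //; split=> //; exists x; rewrite gt_eqF. Qed.

Lemma nneg_harmonicZ M f : 0 <= M -> nneg_harmonic f ->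
  nneg_harmonic (fun x => M * f x).
Proof.
move=> M0 Pf; have [f0 _] := Pf.
(* The zero function is obtained as [f - f]; then [M f] is the difference [M f - 0]. *)
have : nneg_harmonic (fun x => f x - f x).
  by have := nneg_harmonic_sub ler01 Pf Pf;
   under eq_fun do rewrite mul1r; apply=> x; rewrite mul1r.
under eq_fun do rewrite subrr.
move=> P0; have := nneg_harmonic_sub M0 Pf P0; under eq_fun do rewrite subr0.
by apply=> x; rewrite mulr_ge0.
Qed.

Lemma Kset_of_nneg_harmonic x0 f : nneg_harmonic f -> 0 < f x0 ->
  Kset b c x0 (fun x => (f x0)^-1 * f x).
Proof.
move=> Pf fx0; apply: subset_closure; split=> /=; last first.
  by rewrite mulVf// gt_eqF.
apply: (@nneg_harmonic_Hplus _ x0); last by rewrite mulVf ?gt_eqF.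
by apply: nneg_harmonicZ => //; rewrite invr_ge0 ltW.
Qed.

Section Action.
Variables (G : Type) (Gs : group_on G) (act : G -> X -> X).
Hypothesis act_action : is_action Gs act.
Hypothesis inv : H_invariant Gs act b c.

Lemma nneg_harmonic_act g f : nneg_harmonic f ->
  nneg_harmonic (fun x => f (act g x)).
Proof.
move=> [f0 [D H]]; have [D' H'] := inv (ginv Gs g) D.
have TE : Tg Gs act (ginv Gs g) f = (fun x => f (act g x)).
  apply/funext => x; rewrite /Tg; congr f.
  rewrite -[in RHS](actK act_action (ginv Gs g) (act g x)).
  by rewrite (actK act_action g).
split=> [x|] //; split; first by rewrite -TE.
by move=> x; rewrite -TE H' /Tg H.
Qed.

End Action.

(** * Pointwise closed conditions pass to the closure [Kset], whose elements need not be given as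
    harmonic *)

Lemma Kset_closed_property x0 (Q : set {ptws X -> R}) f : closed Q ->
  (forall f, Hplus b c f -> f x0 = 1 -> Q f) -> Kset b c x0 f -> Q f.
Proof.
move=> clQ HQ Kf; apply: clQ; apply: closureS Kf => h [Hh hx0]; exact: HQ.
Qed.

Lemma eval_continuous (x : X) : continuous (fun f : {ptws X -> R} => f x).
Proof. exact: (@proj_continuous X (fun=> R) x). Qed.

Lemma closed_eval_ge0 (x : X) : closed [set f : {ptws X -> R} | 0 <= f x].
Proof.
apply: (@preimage_closed _ _ (fun f : {ptws X -> R} => f x) [set y | 0 <= y]).
  by move=> f _; exact: eval_continuous.
exact: closed_ge.
Qed.

Lemma closed_eval_eq (x y : X) : closed [set f : {ptws X -> R} | f x = f y].
Proof. exact: (closed_equalizer (@eval_continuous x) (@eval_continuous y)). Qed.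

Lemma closed_eval_cst (x : X) (t : R) : closed [set f : {ptws X -> R} | f x = t].
Proof.
apply: (@preimage_closed _ _ (fun f : {ptws X -> R} => f x) [set y | y = t]).
  by move=> f _; exact: eval_continuous.
exact: closed_eq.
Qed.

Lemma Kset_nneg x0 f : Kset b c x0 f -> (forall x, 0 <= f x) /\ f x0 = 1.
Proof.
move=> Kf; split=> [x|].
  by have := Kset_closed_property (@closed_eval_ge0 x) _ Kf; apply=> h [_ [h0 _]] _ /=.
have := Kset_closed_property (@closed_eval_cst x0 1) _ Kf.
by apply.
Qed.

End PositiveHarmonic.

(** * Commutator invariance on the closure, and multiplicativity of harmonic extreme points *)

Theorem theorem1 (R : realType) (X : countType) (b : X -> X -> R) (c : X -> R)
  (G : Type) (Gs : group_on G) (act : G -> X -> X) (x0 : X) :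
  is_graph b c -> connected_graph b ->
  is_action Gs act -> nilpotent_group Gs -> cocompact act ->
  H_invariant Gs act b c ->
  (forall f, Kset b c x0 f -> invariant_on Gs act (commutator_subgroup Gs) f) /\
  (forall f, extreme_pt (Kset b c x0) f -> harmonic_fun b c f ->
     multiplicative_fun Gs act f).
Proof.
move=> graph_bc conn act_action nil [V [finV coverV]] inv.
have P_ge0 f x : nneg_harmonic b c f -> 0 <= f x by case.
have P_act := nneg_harmonic_act act_action inv.
have P_sub := nneg_harmonic_sub graph_bc.
have P_harnack := harnack graph_bc conn.
have comm_inv := commutator_subgroup_kernel act_action finV coverV
  P_ge0 P_act P_sub P_harnack nil.
(* Stability under inverses is kept because [Tg] evaluates at the inverse of [g]. *)
have [_ [_ comm_V]] : is_subgroup Gs (commutator_subgroup Gs).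
  split; first by move=> Q [].
  split=> [a d Ha Hd Q QG sQ|a Ha Q QG sQ].
    by case: (QG) => _ [QM _]; apply: QM; [exact: Ha|exact: Hd].
  by case: (QG) => _ [_ QV]; apply: QV; exact: Ha.
split=> [f Kf g Hg|f [Kf extf] Hf].
  apply/funext => x; rewrite /Tg.
  have := Kset_closed_property (@closed_eval_eq R X (act (ginv Gs g) x) x) _ Kf.
  apply; move=> h /Hplus_nneg_harmonic Ph _ /=.
  by apply: comm_inv Ph; exact: comm_V.
have [f0 fx0] := Kset_nneg Kf.
have Pf : nneg_harmonic b c f by [].
have f_pos x : 0 < f x.
  apply: (Hplus_pos graph_bc conn).
  by apply: (nneg_harmonic_Hplus Pf (x := x0)); rewrite fx0.
(* As [f] and its translates ignore commutators, [G] acts on [f] as an abelian group. *)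
have commute g k x : f (act g (act k x)) = f (act k (act g x)).
  have Hc : commutator_subgroup Gs (gcomm Gs g k).
    by move=> Q _; apply; exists g => //; exists k.
  rewrite -(comm_inv _ Hc _ x (P_act g _ (P_act k _ Pf))).
  by rewrite /gcomm !act_action.2 !(actKV act_action).
have translate g x : f (act g x) = f (act g x0) * f x.
  have [C C0 HC] := uniform_harnack finV P_ge0 P_harnack (act g).
  have le_f y : f (act g y) <= C * f y.
    have [k [v [Vv ->]]] := coverV y; rewrite commute.
    exact: (HC _ v (P_act k f Pf) Vv).1.
  have Pg := P_act g f Pf.
  (* With [C + 1] instead of [C], [u x0] is at least [f x0 = 1], so [u] can be normalized at
     [x0]. *)
  pose u y := (C + 1) * f y - f (act g y).
  have Pu : nneg_harmonic b c u.
    apply: P_sub => //; first by rewrite addr_ge0.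
    by move=> y; rewrite mulrDl mul1r; apply: le_trans (le_f y) _; rewrite lerDl.
  have ux0 : 0 < u x0.
    by rewrite /u mulrDl mul1r; have := le_f x0; have := f_pos x0; lra.
  have C1 : 0 < C + 1 by rewrite ltr_wpDl.
  have gx0 := f_pos (act g x0).
  have uE : u x0 = C + 1 - f (act g x0) by rewrite /u fx0 mulr1.
  (* Dividing [(C + 1) f = f o g + u] by [C + 1] writes [f] as a convex combination of the two
     normalized functions, with weights [f (act g x0) / (C + 1)] and [u x0 / (C + 1)]. *)
  have [] := extf _ _ (f (act g x0) / (C + 1))
    (Kset_of_nneg_harmonic graph_bc Pg gx0) (Kset_of_nneg_harmonic graph_bc Pu ux0).
  - rewrite divr_gt0//= ltr_pdivrMr// mul1r; lra.
  - apply/funext => y.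
    have -> : 1 - f (act g x0) / (C + 1) = u x0 / (C + 1).
      by rewrite uE; field; rewrite gt_eqF.
    rewrite !mulrA.
    have -> : f (act g x0) / (C + 1) / f (act g x0) = (C + 1)^-1.
      by field; rewrite !gt_eqF.
    have -> : u x0 / (C + 1) / u x0 = (C + 1)^-1 by field; rewrite !gt_eqF.
    by rewrite -mulrDr /u (addrC (f _)) subrK mulKf// gt_eqF.
  - by move=> /(congr1 (@^~ x)) /= Ex _; rewrite -Ex mulVKf// gt_eqF.
exists (fun g => f (act g x0)); split=> [g|]; first exact: f_pos.
split=> [g k|g]; first by rewrite act_action.2 translate.
by apply/funext => x; rewrite /Tg translate.
Qed.
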